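(* Let $a=(a_k)_{k\ge1}$ be a sequence of complex numbers with $a_1=0$. For integers $k>l\ge0$ let $Q_{(k,l);a}$ be the multiparameter Schur Q-function of the strict partition $(k,l)$ (equal to $Q_{(k);a}$ if $l=0$), and for $0\le k\le l$ put $Q_{(k,l);a}=-Q_{(l,k);a}$. Let $\lambda$ be a strict partition and set $\lambda_{\ell(\lambda)+1}=0$. Then $$Q_{\lambda;a}=\operatorname{Pf}\Bigl(\bigl(Q_{(\lambda_i,\lambda_j);a}\bigr)_{1\le i,j\le 2[\frac{\ell(\lambda)+1}{2}]}\Bigr),$$ where $[x]$ denotes the integral part of $x$.
   Context: Put $(x\mid a)^k=\prod_{m=1}^k(x-a_m)$, $(x\mid a)^0=1$. For a strict partition $\lambda=(\lambda_1>\dots>\lambda_l>0)$, $\ell(\lambda)=l$, and $m\ge l$, $$P_{\lambda;a}(x_1,\dots,x_m)=\frac1{(m-l)!}\sum_{\omega\in S(m)}\prod_{i=1}^l (x_{\omega(i)}\mid a)^{\lambda_i}\prod_{1\le i\le l,\ i<j\le m}\frac{x_{\omega(i)}+x_{\omega(j)}}{x_{\omega(i)}-x_{\omega(j)}},$$ and $0$ if $m<l$; these form a stable sequence (under $x_{m+1}\mapsto0$) of supersymmetric polynomials, i.e. an element $P_{\lambda;a}$ of the algebra $\Gamma$ of supersymmetric functions, and $Q_{\lambda;a}=2^{\ell(\lambda)}P_{\lambda;a}$. The Pfaffian of a skew-symmetric $2m\times2m$ matrix $A=(a_{ij})$ is $\sum_{\omega}\operatorname{sgn}(\omega)\prod_{i=1}^m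 a_{\omega(2i-1)\omega(2i)}$ over $\omega\in S(2m)$ with $\omega(2i-1)<\omega(2i)$ and $\omega(1)<\omega(3)<\dots<\omega(2m-1)$. *)

(* Defs.v *)
From mathcomp Require Import all_boot all_order all_fingroup all_algebra.
From mathcomp Require Import complex reals.
From mathcomp Require Import mpoly.

Set Implicit Arguments.
Unset Strict Implicit.
Unset Printing Implicit Defensive.

Import GRing.Theory.
Local Open Scope ring_scope.

(* The parts of lam are lam_i = nth 0 lam i.-1, so lam_i = 0 for i > l(lam). *)
Definition strict_partition (lam : seq nat) : bool :=
  sorted gtn lam && (0%N \notin lam).

(* (x | a)^k; the parameter sequence is a_1, a_2, ..., and a 0 is never used. *)
Definition gen_power (K : pzRingType) (a : nat -> K) (x : K) (k : nat) : K :=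
  \prod_(1 <= r < k.+1) (x - a r).

Section SchurPQ.
Variables (F : fieldType) (a : nat -> F).

Definition ratfun (m : nat) : fieldType := {fraction {mpoly F[m]}}.

Definition ratvar (m : nat) (i : 'I_m) : ratfun m := tofrac ('X_i : {mpoly F[m]}).

Definition ratparam (m : nat) (k : nat) : ratfun m :=
  tofrac ((a k)%:MP : {mpoly F[m]}).

(* An element of Gamma is a sequence of supersymmetric polynomials in
   m = 0, 1, 2, ... variables, of bounded degree and stable under x_{m+1} = 0;
   these sequences are added, multiplied and compared termwise.  schurP lam m
   and schurQ lam m are the m-variable terms of P_{lam;a} and Q_{lam;a}, taken
   in the field of fractions (where the polynomial ring embeds), since the
   defining formula has denominators. *)
Definition schurP (lam : seq nat) (m : nat) : ratfun m :=
  if (size lam <= m)%N then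
    ((m - size lam)`!%:R)^-1 *
    \sum_(w : 'S_m)
      (\prod_(i < m | (i < size lam)%N)
          gen_power (ratparam m) (ratvar (w i)) (nth 0%N lam i)) *
      (\prod_(i < m | (i < size lam)%N) \prod_(j < m | (i < j)%N)
          ((ratvar (w i) + ratvar (w j)) / (ratvar (w i) - ratvar (w j))))
  else 0.

Definition schurQ (lam : seq nat) (m : nat) : ratfun m :=
  2%:R ^+ size lam * schurP lam m.

(* The zero part is dropped, so that (k, 0) is (k).  Skew-symmetry forces the
   value 0 for k = l. *)
Definition schurQ2 (k l m : nat) : ratfun m :=
  let Q k l := schurQ [seq p <- [:: k; l] | (0 < p)%N] m in
  if (l < k)%N then Q k l else if (k < l)%N then - Q l k else 0.

End SchurPQ.

Section Pfaffian.
Variables (K : comPzRingType) (m : nat).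

Lemma pf_fst_subproof (i : 'I_m) : (i.*2 < m.*2)%N.
Proof. by rewrite ltn_double. Qed.

Lemma pf_snd_subproof (i : 'I_m) : (i.*2.+1 < m.*2)%N.
Proof. by rewrite ltn_Sdouble. Qed.

(* With indices starting from 0, the pairs (2i-1, 2i) become (2i, 2i+1). *)
Definition pf_fst (i : 'I_m) : 'I_(m.*2) := Ordinal (pf_fst_subproof i).
Definition pf_snd (i : 'I_m) : 'I_(m.*2) := Ordinal (pf_snd_subproof i).

Definition pf_perm (w : 'S_(m.*2)) : bool :=
  [forall i : 'I_m, (w (pf_fst i) < w (pf_snd i))%N] &&
  [forall i : 'I_m, forall j : 'I_m,
     (i < j)%N ==> (w (pf_fst i) < w (pf_fst j))%N].

Definition pfaffian (A : 'M[K]_(m.*2)) : K :=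
  \sum_(w : 'S_(m.*2) | pf_perm w)
     (-1) ^+ w * \prod_(i < m) A (w (pf_fst i)) (w (pf_snd i)).

End Pfaffian.

(* Main.v *)
(* Put c_i = \prod_(j != i) (x_i + x_j) / (x_i - x_j).  In Q_lam the product over
   pairs absorbs into weights c_(w i) up to the factor
   \prod_(i < j <= l) (x_wj - x_wi) / (x_wj + x_wi), so Q_lam becomes a sum over
   the injections v of the parts into the variables; since this factor vanishes
   whenever v repeats a value, the sum may be taken over all maps v.  Schur's
   Pfaffian identity \prod_(i < j) (z_i - z_j) / (z_i + z_j) =
   Pf ((z_i - z_j) / (z_i + z_j)), at z = 1 / x and with an extra z = 0 when l is
   odd, turns each summand into a Pfaffian, and multilinearity of the Pfaffian
   lets the sum over v be performed separately on each pair of indices.  The same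
   formula for one or two parts identifies the resulting entries.

   Schur's identity is proved by expansion along the first row; the induction
   step is the partial fraction expansion of \prod_k (t + z_k) / (t - z_k) at
   t = - z_0. *)
Require Import Defs.
From mathcomp Require Import all_boot all_order all_fingroup all_algebra.
From mathcomp Require Import complex reals.
From mathcomp Require Import mpoly.
From mathcomp Require Import ring zify.

Set Implicit Arguments.
Unset Strict Implicit.
Unset Printing Implicit Defensive.

Import Order.TTheory GRing.Theory Num.Theory.
Local Open Scope ring_scope.

(** * Permutations with a prescribed value, and the pairings of the Pfaffian *)

Lemma lift_perm_onto n (i j : 'I_n.+1) (s : 'S_n.+1) :
  s i = j -> exists t, s = lift_perm i j t.
Proof.
move=> sij; pose f k := odflt k (unlift j (s (lift i k))).
have fK k : lift j (f k) = s (lift i k).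
  rewrite /f -sij; have: s i != s (lift i k) by rewrite (inj_eq perm_inj) neq_lift.
  by case/unlift_some=> ? ? ->.
have f_inj : injective f.
  by move=> k k' /(congr1 (lift j)); rewrite !fK => /perm_inj /lift_inj.
exists (perm f_inj); apply/permP => k; case: (unliftP i k) => [k'|] ->.
  by rewrite lift_perm_lift permE fK.
by rewrite lift_perm_id.
Qed.

Lemma lift_perm_inj n (i j : 'I_n.+1) : injective (lift_perm i j).
Proof.
move=> s t /permP st; apply/permP => k; apply: (@lift_inj _ j).
by rewrite -!(lift_perm_lift i) st.
Qed.

Lemma lift_perm_bij n (i j : 'I_n.+1) (P : pred 'S_n.+1) :
  (forall s, P s -> s i = j) -> {on P, bijective (lift_perm i j)}.
Proof.
move=> Pij; exists (fun s => odflt 1%g [pick t | lift_perm i j t == s]) => s.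
  by move=> _; case: pickP => [t /eqP/lift_perm_inj // | /(_ s)]; rewrite eqxx.
move=> /Pij/lift_perm_onto[t ->].
by case: pickP => [u /eqP // | /(_ t)]; rewrite eqxx.
Qed.

Lemma ltn_lift2 n (h : 'I_n) i j : (lift h i < lift h j)%N = (i < j)%N.
Proof. by rewrite !ltnNge leq_bump2. Qed.

(** The value 0 stands neither second in its pair nor first in a later pair, since a smaller value
    would have to precede it. *)
Lemma pf_perm0 M (w : 'S_(M.+1.*2)) : pf_perm w -> w ord0 = ord0.
Proof.
case/andP=> /forallP/= ltw1 /forallP/= ltw2.
suff: (w^-1)%g ord0 = ord0 by move=> /(congr1 w); rewrite permKV.
set k := (w^-1)%g _; have wk : w k = ord0 by rewrite permKV.
have kM : (k./2 < M.+1)%N by rewrite ltn_half_double.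
pose i := Ordinal kM.
have [ko|ke] := boolP (odd k).
  have := ltw1 i; suff -> : @pf_snd M.+1 i = k by rewrite wk.
  by apply/val_inj; rewrite /= -{2}[nat_of_ord k]odd_double_half ko.
have ki : @pf_fst M.+1 i = k.
  by apply/val_inj; rewrite /= -{2}[nat_of_ord k]odd_double_half (negPf ke).
have [i0|i0] := posnP i.
  by rewrite -ki; apply/val_inj; rewrite /= -[k./2]/(nat_of_ord i) i0.
by have /forallP/(_ i)/implyP/(_ i0) := ltw2 ord0; rewrite ki wk.
Qed.

(** [w'] pairs 0 with [lift ord0 j] and the remaining indices as [w] does. *)
Lemma lift_perm_pairs M (j : 'I_(M.*2.+1)) (w : 'S_(M.*2))
    (w' := lift_perm ord0 ord0 (lift_perm ord0 j w)) :
  [/\ w' (@pf_fst M.+1 ord0) = ord0,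
      w' (@pf_snd M.+1 ord0) = lift ord0 j,
      forall i, w' (@pf_fst M.+1 (lift ord0 i)) = lift ord0 (lift j (w (pf_fst i))) &
      forall i, w' (@pf_snd M.+1 (lift ord0 i)) = lift ord0 (lift j (w (pf_snd i)))].
Proof.
split=> [||i|i].
- by rewrite (_ : @pf_fst M.+1 _ = ord0) ?lift_perm_id //; apply/val_inj.
- rewrite -(lift_perm_id ord0 j w) -(lift_perm_lift ord0 ord0).
  by congr (w' _); apply/val_inj.
- rewrite -(lift_perm_lift ord0 j) -(lift_perm_lift ord0 ord0).
  by congr (w' _); apply/val_inj.
rewrite -(lift_perm_lift ord0 j) -(lift_perm_lift ord0 ord0).
by congr (w' _); apply/val_inj.
Qed.

Lemma pf_perm_lift M (j : 'I_(M.*2.+1)) (w : 'S_(M.*2)) :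
  @pf_perm M.+1 (lift_perm ord0 ord0 (lift_perm ord0 j w)) = pf_perm w.
Proof.
have [w'0 w's0 w'f w's] := lift_perm_pairs j w.
apply/andP/andP => -[/forallP/= lt1 /forallP/= lt2]; split; apply/forallP => i.
- by have := lt1 (lift ord0 i); rewrite w'f w's !ltn_lift2.
- apply/forallP => i'; have /forallP/(_ (lift ord0 i')) := lt2 (lift ord0 i).
  by rewrite !w'f !ltn_lift2.
- case: (unliftP ord0 i) => [i'|] ->; last by rewrite w'0 w's0.
  by rewrite w'f w's !ltn_lift2.
apply/forallP => i'; case: (unliftP ord0 i') => [k'|] -> //.
case: (unliftP ord0 i) => [k|] ->; last by rewrite w'0 w'f.
by rewrite !w'f !ltn_lift2; have /forallP := lt2 k.
Qed.

(** * Expansion of the Pfaffian along the first row *)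

Section PfaffianExpansion.
Variable K : comPzRingType.

Lemma pfaffian0 (A : 'M[K]_(0.*2)) : pfaffian A = 1.
Proof.
rewrite /pfaffian (bigD1 1%g) /=; last first.
  by apply/andP; split; apply/forallP; case.
rewrite big_ord0 odd_perm1 mulr1 big1 ?addr0 // => w /andP[_ /negP[]].
by apply/eqP/permP; case.
Qed.

(** Pairings are sorted by the partner of 0. Inserting 0 costs no sign, inserting its partner costs
    (-1)^j. *)
Lemma pfaffian_expand_row0 M (A : 'M[K]_(M.+1.*2)) :
  pfaffian A = \sum_(j < M.*2.+1) (-1) ^+ j * A ord0 (lift ord0 j) *
     pfaffian (\matrix_(i, k) A (lift ord0 (lift j i)) (lift ord0 (lift j k))).
Proof.
rewrite /pfaffian.
transitivity (\sum_(w : 'S_(M.*2.+2) | (w ord0 == ord0) && @pf_perm M.+1 w)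
   (-1) ^+ w * \prod_(i < M.+1) A (w (pf_fst i)) (w (pf_snd i))).
  apply: eq_bigl => w; case E: (pf_perm _); rewrite ?andbF //.
  by rewrite (pf_perm0 E) eqxx.
rewrite (reindex (lift_perm ord0 ord0)) /=; last by apply: lift_perm_bij => w /andP[/eqP].
rewrite (partition_big (fun w : 'S_(M.*2.+1) => w ord0) predT) //=.
apply: eq_bigr => j _.
rewrite (reindex (lift_perm ord0 j)) /=; last by apply: lift_perm_bij => w /andP[_ /eqP].
rewrite big_distrr /=; apply: eq_big => w.
  by rewrite -(pf_perm_lift j) !lift_perm_id !eqxx andbT.
move=> _; rewrite !odd_lift_perm /= signr_addb signr_odd.
have [w'0 w's0 w'f w's] := lift_perm_pairs j w.
rewrite big_ord_recl /= w'0 w's0 mulrACA; congr (_ * _ * (_ * _)).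
by apply: eq_bigr => i _; rewrite w'f w's mxE.
Qed.

End PfaffianExpansion.

(** * Partial fractions and Schur's Pfaffian identity *)

Section SchurPfaffian.
Variable K : fieldType.

Definition qratio (x y : K) := (x - y) / (x + y).

Definition qprod n (z : 'I_n -> K) :=
  \prod_(i < n) \prod_(j < n | (j < i)%N) qratio (z j) (z i).

Lemma qratioC x y : qratio y x = - qratio x y.
Proof. by rewrite /qratio (addrC y x) -mulNr opprB. Qed.

Lemma qratioV x y : (qratio x y)^-1 = (x + y) / (x - y).
Proof. by rewrite /qratio invf_div. Qed.

Lemma prod_sign_ltn n j : (j <= n)%N ->
  \prod_(k < n) (if (k < j)%N then -1 else 1) = (-1) ^+ j :> K.
Proof.
elim: n j => [|n IHn] j; first by rewrite leqn0 => /eqP->; rewrite big_ord0.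
rewrite leq_eqVlt => /orP[/eqP->|jn].
  rewrite (eq_bigr (fun=> -1)) => [|k _]; last by rewrite ltn_ord.
  by rewrite prodr_const card_ord.
by rewrite big_ord_recr /= IHn // ltnNge -ltnS jn mulr1.
Qed.

(** The j factors whose other index lies below j occur with reversed arguments, and [qratio] is
    antisymmetric; hence the sign. *)
Lemma qprod_lift n (z : 'I_n.+1 -> K) (j : 'I_n.+1) :
  qprod z = (-1) ^+ j * \prod_(k < n) qratio (z j) (z (lift j k)) *
            qprod (z \o lift j).
Proof.
have E k : \prod_(i < n.+1 | (i < lift j k)%N) qratio (z i) (z (lift j k)) =
    (if (j < lift j k)%N then qratio (z j) (z (lift j k)) else 1) *
    \prod_(i < n | (i < k)%N) qratio (z (lift j i)) (z (lift j k)).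
  rewrite big_mkcond (bigD1_ord j) //= -big_mkcond; congr (_ * _).
  by apply: eq_bigl => i; rewrite ltn_lift2.
rewrite /qprod (bigD1_ord j) //= (eq_bigr _ (fun k _ => E k)).
rewrite [X in X * _]big_mkcond (bigD1_ord j) //= ltnn mul1r.
rewrite [X in _ * X = _]big_split mulrA; congr (_ * _).
rewrite -(@prod_sign_ltn n j) -1?ltnS // -!big_split /=.
apply: eq_bigr => k _; rewrite /bump; case: (leqP j k) => jk.
  by rewrite add1n ltnS jk ltnNge leqW ?mul1r.
by rewrite add0n jk ltnNge (ltnW jk) mulr1 mulN1r qratioC.
Qed.

Lemma qprod_eq0 n (z : 'I_n -> K) i j : i != j -> z i = z j -> qprod z = 0.
Proof.
case: n z i j => [|n] z i j; first by case: i.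
case/unlift_some => k -> _ zij; rewrite (qprod_lift z i) (bigD1 k) //=.
by rewrite zij /qratio subrr mul0r mul0r mulr0 mul0r.
Qed.

(* Two equal values only occur in the sum over all maps, and are not covered by
   the partial fractions: there the expansion cancels in pairs. *)
Lemma qprod_lift_eq n (y : 'I_n.+2 -> K) (a b : 'I_n.+2) :
  a != b -> y a = y b ->
  (-1) ^+ a * qprod (y \o lift a) = - ((-1) ^+ b * qprod (y \o lift b)).
Proof.
wlog ltab : a b / (a < b)%N => [th ab yab|_ yab].
  have [|ltba|/val_inj/eqP] := ltngtP a b; first by move/th; apply.
    by rewrite (th b a) ?opprK // eq_sym.
  by rewrite (negPf ab).
have a'P : (a < n.+1)%N by have := ltn_ord b; lia.
have b'P : (b.-1 < n.+1)%N by have := ltn_ord b; lia.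
pose a' := Ordinal a'P; pose b' := Ordinal b'P.
have aE : lift b a' = a by apply/val_inj; rewrite /= /bump; lia.
have bE : lift a b' = b by apply/val_inj; rewrite /= /bump; lia.
have liftC k : lift b (lift a' k) = lift a (lift b' k).
  by apply/val_inj; rewrite /= /bump; lia.
rewrite (qprod_lift _ b') (qprod_lift (y \o lift b) a') /= aE bE yab !mulrA.
have -> : qprod ((y \o lift b) \o lift a') = qprod ((y \o lift a) \o lift b').
  by apply: eq_bigr => i _; apply: eq_bigr => j _; rewrite /= !liftC.
rewrite (eq_bigr _ (fun k _ => congr1 (fun u => qratio (y b) (y u)) (liftC k))).
rewrite -!mulNr; congr (_ * _ * _).
by rewrite -{2}[nat_of_ord b]prednK ?(leq_ltn_trans _ ltab) // exprS mulrC !mulNr mul1r opprK.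
Qed.

Lemma size_monicB (p q : {poly K}) n :
  p \is monic -> q \is monic -> size p = n.+1 -> size q = n.+1 ->
  (size (p - q)%R <= n)%N.
Proof.
move=> /monicP pm /monicP qm sp sq; apply/leq_sizeP => i; rewrite leq_eqVlt coefB.
case/orP => [/eqP<-|ni]; last by rewrite !nth_default ?subrr // ?sp ?sq.
by move: pm qm; rewrite !lead_coefE sp sq /= => -> ->; rewrite subrr.
Qed.

(** For distinct z_k, this coefficient gives (t + z_j) / (t - z_j) the residue of the product of all
    (t + z_k) / (t - z_k) at t = z_j. *)
Definition qweight n (z : 'I_n -> K) j :=
  \prod_(k < n | k != j) ((z j + z k) / (z j - z k)).

(** After multiplication by N(t) the identity reads H(t) = 0. H combines differences of monic
    polynomials of degree n, so its degree is below n, and it vanishes at the n points z_i. *)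
Lemma qweight_partial_fractions n (z : 'I_n -> K) t :
  injective z -> (forall i, t != z i) ->
  \prod_k ((t + z k) / (t - z k)) -
    \sum_j qweight z j * ((t + z j) / (t - z j)) = 1 - \sum_j qweight z j.
Proof.
move=> z_inj tz.
pose N := \prod_k ('X - (z k)%:P); pose P := \prod_k ('X - (- z k)%:P).
pose L j := ('X - (- z j)%:P) * \prod_(k | k != j) ('X - (z k)%:P).
have Nm : N \is monic by apply: monic_prod => k _; apply: monicXsubC.
have Pm : P \is monic by apply: monic_prod => k _; apply: monicXsubC.
have Lm j : L j \is monic.
  by rewrite monicMl ?monicXsubC //; apply: monic_prod => k _; apply: monicXsubC.
have sN : size N = n.+1.
  by rewrite size_prod_XsubC [index_enum _]unlock /= -enumT size_enum_ord.
have sP : size P = n.+1.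
  by rewrite (size_prod_XsubC _ (fun k => - z k)) [index_enum _]unlock /= -enumT size_enum_ord.
have NE j u : N.[u] = (u - z j) * \prod_(k | k != j) (u - z k).
  by rewrite horner_prod (bigD1 j) //= hornerXsubC; under eq_bigr do rewrite hornerXsubC.
have PE u : P.[u] = \prod_k (u + z k).
  by rewrite horner_prod; apply: eq_bigr => k _; rewrite hornerXsubC opprK.
have LE j u : (L j).[u] = (u + z j) * \prod_(k | k != j) (u - z k).
  rewrite hornerM hornerXsubC opprK horner_prod.
  by congr (_ * _); apply: eq_bigr => k _; rewrite hornerXsubC.
have sL j : size (L j) = n.+1.
  have M0 : \prod_(k | k != j) ('X - (z k)%:P) != 0.
    by apply/monic_neq0/monic_prod => k _; apply: monicXsubC.
  by have := sN; rewrite /N /L (bigD1 j) //= !size_monicM ?monicXsubC ?size_XsubC.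
pose H := (P - N) - \sum_j (qweight z j) *: (L j - N).
have HE u : H.[u] = P.[u] - N.[u] - \sum_j qweight z j * ((L j).[u] - N.[u]).
  rewrite hornerD hornerN hornerD hornerN horner_sum; congr (_ - _).
  by apply: eq_bigr => j _; rewrite hornerZ hornerD hornerN.
have H0 : H = 0.
  apply: (@roots_geq_poly_eq0 _ _ (codom z)); last 2 first.
  - by rewrite map_inj_uniq ?enum_uniq.
  - rewrite size_codom card_ord (leq_trans (size_polyD _ _)) // geq_max.
    rewrite size_monicB //= size_polyN; apply: leq_trans (size_sum _ _ _) _.
    apply/bigmax_leqP => j _; apply: leq_trans (size_scale_leq _ _) _.
    exact: size_monicB.
  (* At z_i only P and L_i survive, and P(z_i) is the weight of z_i times L_i(z_i). *)
  apply/allP => _ /codomP[i ->]; rewrite /root HE.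
  have N0 : N.[z i] = 0 by rewrite (NE i) subrr mul0r.
  rewrite N0 (bigD1 i) //= big1 => [|j ji]; last first.
    by rewrite LE (bigD1 i) 1?eq_sym //= subrr mul0r mulr0 subrr mulr0.
  rewrite !subr0 addr0 LE PE (bigD1 i) //= mulrCA -big_split /= -mulrBr.
  rewrite mulf_eq0 subr_eq0; apply/orP; right; apply/eqP.
  by apply: eq_bigr => k ki; rewrite divfK // subr_eq0 (inj_eq z_inj) eq_sym.
have tz0 i : t - z i != 0 by rewrite subr_eq0.
have Nt : N.[t] = \prod_k (t - z k).
  by rewrite horner_prod; apply: eq_bigr => k _; rewrite hornerXsubC.
have Nt0 : N.[t] != 0 by rewrite Nt; apply/prodf_neq0.
have Lt j : (t + z j) / (t - z j) = (L j).[t] / N.[t].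
  rewrite (NE j) LE -mulf_div divff ?mulr1 //.
  by apply/prodf_neq0.
rewrite prodf_div -Nt -PE; under eq_bigr => j _ do rewrite Lt.
apply: (mulIf Nt0); apply/eqP; rewrite -subr_eq0.
move: (HE t); rewrite H0 horner0 => e; rewrite [X in _ == X]e; apply/eqP.
under [in RHS]eq_bigr do rewrite mulrBr.
rewrite sumrB -mulr_suml.
under eq_bigr do rewrite mulrA.
rewrite -mulr_suml; field.
exact: Nt0.
Qed.

(** With z_0 as t and the other values as poles, the left side of the partial fraction identity is
    the full sum of weights. So the sum for n + 1 values is 1 minus a sum for n values. *)
Lemma sum_qweight n (z : 'I_n -> K) : injective z ->
  \sum_j qweight z j = (odd n)%:R.
Proof.
elim: n z => [|n IHn] z z_inj; first by rewrite big_ord0.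
rewrite big_ord_recl /=.
have yinj : injective (z \o lift ord0) by move=> i j /z_inj/lift_inj.
have := qweight_partial_fractions (t := z ord0) yinj.
rewrite IHn // => /(_ _)/= E.
transitivity (1 - (odd n)%:R : K); last by case: (odd n); rewrite ?subrr ?subr0.
rewrite -E => [|i]; last by rewrite (inj_eq z_inj) neq_lift.
congr (_ + _); first by rewrite /qweight big_mkcond big_ord_recl /= mul1r.
rewrite -sumrN; apply: eq_bigr => j _.
rewrite /qweight (bigD1 ord0) //= -mulrN mulrC; congr (_ * _).
  rewrite big_mkcond big_ord_recl /= mul1r [RHS]big_mkcond.
  by apply: eq_bigr => k _; rewrite andbT (inj_eq (@lift_inj _ _)).
by rewrite addrC -mulrN -invrN opprB.
Qed.

Lemma qratio_expand n (y : 'I_n.+1 -> K) x : ~~ odd n ->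
  (forall i j, i != j -> y i + y j != 0) -> (forall i, x + y i != 0) ->
  \sum_(j < n.+1) (-1) ^+ j * qratio x (y j) * qprod (y \o lift j) =
  (\prod_j qratio x (y j)) * qprod y.
Proof.
move=> n_even yy xy.
have [/injectiveP y_inj|/injectivePn[a [b ab yab]]] := boolP (injectiveb y).
  (* The number n + 1 of values is odd, so the weights sum to 1 and the right side vanishes; t = - x
     produces the factors [qratio x (y k)]. *)
  have := qweight_partial_fractions (t := - x) y_inj.
  rewrite sum_qweight //= n_even subrr => E.
  have {}E : \sum_j qweight y j * qratio x (y j) = \prod_k qratio x (y k).
    have xE k : (- x + y k) / (- x - y k) = qratio x (y k).
      by rewrite addrC -opprB -opprD mulNr invrN mulrN opprK.
    symmetry; apply/subr0_eq; rewrite -[RHS]E => [|i].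
      by congr (_ - _); apply: eq_bigr => k _; rewrite xE.
    by rewrite eq_sym -subr_eq0 opprK addrC xy.
  rewrite -E mulr_suml; apply: eq_bigr => j _.
  (* Omitting y_j removes from [qprod y] the factors containing y_j, which up to the sign are
     inverse to those of the weight. *)
  suff wD : (-1) ^+ j * qprod (y \o lift j) = qweight y j * qprod y.
    by rewrite mulrAC wD mulrAC.
  rewrite (qprod_lift y j).
  have -> : qweight y j = \prod_k (qratio (y j) (y (lift j k)))^-1.
    rewrite /qweight big_mkcond (bigD1_ord j) //= eqxx mul1r.
    by apply: eq_bigr => k _; rewrite eq_sym neq_lift qratioV.
  rewrite prodfV mulrA mulrCA mulVf ?mulr1 //.
  apply/prodf_neq0 => k _; rewrite mulf_neq0 ?invr_eq0 ?yy ?neq_lift //.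
  by rewrite subr_eq0 (inj_eq y_inj) neq_lift.
(* Since y_a = y_b, every term omitting neither of them vanishes, and the two remaining terms
   cancel. *)
rewrite (qprod_eq0 ab yab) mulr0 (bigD1 a) //= (bigD1 b) 1?eq_sym //=.
rewrite [X in _ + (_ + X)]big1 ?addr0; last first.
  move=> j /andP[/unlift_some[a' aE _] /unlift_some[b' bE _]].
  rewrite (@qprod_eq0 _ _ a' b') ?mulr0 //= -?aE -?bE //.
  by rewrite -(inj_eq (@lift_inj _ j)) -aE -bE.
case: n => [|n] in y a b ab yab {n_even yy xy} *.
  by case/eqP: ab; rewrite [a]ord1 [b]ord1.
by rewrite mulrAC (qprod_lift_eq ab yab) mulNr [X in _ + X]mulrAC yab addNr.
Qed.

(** The minors in the expansion have the same form. Values may coincide and one of them may be 0;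
    both cases occur below. *)
Lemma schur_pfaffian M (z : 'I_(M.*2) -> K) :
  (forall i j, i != j -> z i + z j != 0) ->
  pfaffian (\matrix_(i, j) qratio (z i) (z j)) = qprod z.
Proof.
elim: M z => [|M IHM] z zz.
  by rewrite pfaffian0 /qprod big_ord0.
rewrite pfaffian_expand_row0.
rewrite (@qprod_lift (M.*2.+1) z ord0) expr0 mul1r -qratio_expand.
- apply: eq_bigr => j _; rewrite !mxE; congr (_ * _).
  rewrite -IHM => [|i k ik].
    by congr pfaffian; apply/matrixP => i k; rewrite !mxE.
  by rewrite zz // !(inj_eq lift_inj).
- by rewrite odd_double.
- by move=> i j ij; rewrite zz // (inj_eq lift_inj).
by move=> i; rewrite zz // neq_lift.
Qed.

End SchurPfaffian.

(** * Multilinearity of the Pfaffian *)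

Section PfaffianMultilinear.
Variable K : comPzRingType.

(** Each pair has its smaller index first, so only entries above the diagonal enter. *)
Lemma eq_pfaffian M (A B : 'M[K]_(M.*2)) :
  (forall i j : 'I_(M.*2), (i < j)%N -> A i j = B i j) -> pfaffian A = pfaffian B.
Proof.
move=> AB; apply: eq_bigr => w /andP[/forallP/= w_lt _].
by congr (_ * _); apply: eq_bigr => i _; apply: AB.
Qed.

Lemma pfaffian2 (A : 'M[K]_(1.*2)) : pfaffian A = A ord0 ord_max.
Proof.
rewrite (@pfaffian_expand_row0 _ 0) big_ord1 expr0 mul1r (@pfaffian0 K) mulr1.
by congr (A _ _); apply/val_inj.
Qed.

Lemma big_ord_pairs M (G : 'I_(M.*2) -> K) :
  \prod_k G k = \prod_(i < M) (G (pf_fst i) * G (pf_snd i)).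
Proof.
elim: M G => [|M IHM] G; first by rewrite !big_ord0.
rewrite [LHS]big_ord_recl big_ord_recl [RHS]big_ord_recl mulrA; congr (_ * _ * _).
- by congr G; apply/val_inj.
- by congr G; apply/val_inj.
rewrite IHM; apply: eq_bigr => i _.
by congr (G _ * G _); apply/val_inj.
Qed.

(** Every index occurs exactly once in each term, so the weights give the same product for every
    pairing. *)
Lemma pfaffian_bilinear (T : finType) M (B : T -> T -> K) (h : 'I_(M.*2) -> T -> K) :
  pfaffian (\matrix_(i, j) \sum_s \sum_t h i s * h j t * B s t) =
  \sum_(v : {ffun 'I_(M.*2) -> T})
     (\prod_i h i (v i)) * pfaffian (\matrix_(i, j) B (v i) (v j)).
Proof.
rewrite /pfaffian; under [RHS]eq_bigr do rewrite big_distrr /=.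
rewrite exchange_big; apply: eq_bigr => w _ /=.
under [RHS]eq_bigr do rewrite mulrCA.
rewrite -big_distrr /=; congr (_ * _).
under eq_bigr do rewrite mxE pair_big /=.
rewrite bigA_distr_bigA /=.
have half_lt (k : 'I_(M.*2)) : (k./2 < M)%N by rewrite ltn_half_double.
(* A map on all indices amounts to a choice of two values for each pair of [w]; [split] and [join]
   translate between them. *)
pose split (v : {ffun 'I_(M.*2) -> T}) :=
  [ffun i : 'I_M => (v (w (pf_fst i)), v (w (pf_snd i)))].
pose join (p : {ffun 'I_M -> T * T}) := [ffun k : 'I_(M.*2) =>
  let k' := (w^-1)%g k in let q := p (Ordinal (half_lt k')) in
  if odd k' then q.2 else q.1].
have splitE v i : split v i = (v (w (pf_fst i)), v (w (pf_snd i))) by rewrite ffunE.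
rewrite (reindex split); last first.
  exists join => [v _|p _]; apply/ffunP => k.
    rewrite ffunE /= !splitE; set k' := (w^-1)%g k.
    have -> : k = w k' by rewrite permKV.
    by case: ifP => ko; congr (v (w _)); apply/val_inj;
       rewrite /= -{2}[nat_of_ord k']odd_double_half ko.
  rewrite splitE !ffunE !permK /= odd_double.
  have -> : Ordinal (half_lt (pf_fst k)) = k.
    by apply/val_inj; rewrite /= doubleK.
  have -> : Ordinal (half_lt (pf_snd k)) = k.
    by apply/val_inj; rewrite /= uphalf_double.
  by case: (p k).
apply: eq_bigr => v _; rewrite (reindex_perm w) big_ord_pairs -big_split /=.
by apply: eq_bigr => i _; rewrite splitE mxE.
Qed.

End PfaffianMultilinear.

(** * Extensions of an injection to a permutation *)

Lemma perm_extend m l (lm : (l <= m)%N) (u : 'I_l -> 'I_m) : injective u ->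
  exists w : 'S_m, forall i, w (widen_ord lm i) = u i.
Proof.
elim: l lm u => [|l IHl] lm u u_inj; first by exists 1%g; case.
have [|w wE] := IHl (ltnW lm) (u \o widen_ord (leqnSn l)).
  by move=> i j /u_inj/(congr1 val)/= ij; apply/val_inj.
pose a := widen_ord lm ord_max.
(* The transposition gives the last index its prescribed value and fixes the earlier values, which
   differ from both [w a] and [u ord_max]. *)
exists (w * tperm (w a) (u ord_max))%g => i; rewrite permM.
have [il|il] := eqVneq i ord_max; first by rewrite il tpermL.
have {}il : (i < l)%N.
  by rewrite ltn_neqAle -ltnS ltn_ord andbT; apply: contra il => /eqP il; apply/eqP/val_inj.
have iE : i = widen_ord (leqnSn l) (Ordinal il) by apply/val_inj.
have -> : widen_ord lm i = widen_ord (ltnW lm) (Ordinal il) by apply/val_inj.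
rewrite wE /= -iE tpermD //.
  rewrite iE -[u _]/((u \o widen_ord (leqnSn l)) (Ordinal il)) -wE (inj_eq perm_inj).
  by rewrite -val_eqE /= gtn_eqF.
by rewrite (inj_eq u_inj) iE -val_eqE /= gtn_eqF.
Qed.

(** Multiplication by the inverse of one extension turns all of them into the permutations fixing
    the first l indices. *)
Lemma card_perm_extend m l (lm : (l <= m)%N) (u : 'I_l -> 'I_m) : injective u ->
  #|[set w : 'S_m | [forall i, w (widen_ord lm i) == u i]]| = (m - l)`!.
Proof.
move=> /(perm_extend lm)[w0 w0E].
transitivity #|perm_on [set i : 'I_m | (l <= i)%N]|; last first.
  rewrite card_perm; congr (_ `!); rewrite -sum1_card.
  under eq_bigl do rewrite inE.
  transitivity (\sum_(l <= i < m) 1)%N; first by rewrite big_geq_mkord.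
  by rewrite sum_nat_const_nat muln1.
rewrite -[RHS]cardsE -[RHS](card_preimset _ (mulIg (w0^-1)%g)); apply: eq_card => w; rewrite !inE.
apply/forallP/subsetP => [wu i|wl i].
  rewrite !inE. rewrite permM leqNgt; apply: contra => il.
  have -> : i = widen_ord lm (Ordinal il) by apply/val_inj.
  by rewrite (eqP (wu _)) -w0E permK.
apply/eqP; rewrite -w0E; apply/(can_inj (permK (w0^-1)%g)); rewrite permK -permM.
apply/eqP; apply: contraT => ne; have := wl (widen_ord lm i).
by rewrite !inE ne leqNgt /= ltn_ord => /(_ isT).
Qed.

(** * The symmetrised sum as a Pfaffian *)

Section SchurQFormula.
Variables (K : fieldType) (m : nat) (x : 'I_m -> K) (f : nat -> 'I_m -> K).
Hypothesis natK : forall n, n.+1%:R != 0 :> K.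
Hypothesis x_add : forall i j, x i + x j != 0.
Hypothesis x_inj : injective x.

Let x_neq0 i : x i != 0.
Proof. by have := x_add i i; apply: contraNneq => ->; rewrite addr0. Qed.

Lemma qratio_inv (u v : K) :
  u != 0 -> v != 0 -> u + v != 0 -> qratio u^-1 v^-1 = qratio v u.
Proof.
move=> u0 v0 uv; rewrite /qratio; field.
by rewrite u0 v0 addrC uv.
Qed.

(* The variables are inverted so that the extra index needed for an odd number
   of parts, a variable at infinity, becomes the finite value 0. *)
Definition invvar (o : option 'I_m) : K := if o is Some i then (x i)^-1 else 0.

(** A positive part takes only variables, a zero part only [None]. The factor 2^l is spread over the
    parts. *)
Definition part_weight p (o : option 'I_m) : K :=
  if o is Some i then
    if (0 < p)%N then 2%:R * f p i * \prod_(j | j != i) ((x i + x j) / (x i - x j))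
    else 0
  else (p == 0%N)%:R.

Definition pair_sum p q : K :=
  \sum_s \sum_t part_weight p s * part_weight q t * qratio (invvar s) (invvar t).

Definition symm_sum (lam : seq nat) (w : 'S_m) : K :=
  (\prod_(i < m | (i < size lam)%N) f (nth 0%N lam i) (w i)) *
  (\prod_(i < m | (i < size lam)%N) \prod_(j < m | (i < j)%N)
     ((x (w i) + x (w j)) / (x (w i) - x (w j)))).

Section Parts.
Variables (lam : seq nat) (M : nat).
Hypothesis lam_gt0 : forall i, (i < size lam)%N -> (0 < nth 0%N lam i)%N.
Hypothesis l_le : (size lam <= M.*2)%N.
Hypothesis l_ge : (M.*2 <= (size lam).+1)%N.
Let l := size lam.

(** The bounds make [M.*2] the number of parts rounded up to an even number; the default value of
    [nth] supplies the extra zero part. *)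
Definition expand_term (v : {ffun 'I_(M.*2) -> option 'I_m}) : K :=
  (\prod_(i < M.*2) part_weight (nth 0%N lam i) (v i)) * qprod (invvar \o v).

Lemma part_weight_neq0 (v : {ffun 'I_(M.*2) -> option 'I_m}) :
  \prod_(i < M.*2) part_weight (nth 0%N lam i) (v i) != 0 ->
  (exists u : 'I_l -> 'I_m, forall i, v (widen_ord l_le i) = Some (u i)) /\
  forall k : 'I_(M.*2), (l <= k)%N -> v k = None.
Proof.
move/prodf_neq0 => nz; split=> [|k lk].
  apply: (@fin_all_exists _ (fun=> 'I_m) (fun i t => v (widen_ord l_le i) = Some t)).
  move=> i; have := nz (widen_ord l_le i) isT.
  case: (v _) => [t|]; first by exists t.
  by rewrite /= eqn0Ngt lam_gt0 ?eqxx.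
by have := nz k isT; case: (v k) => //= t; rewrite nth_default ?eqxx.
Qed.

(** Since [M.*2] exceeds the number of parts by at most one, at most one index goes to [None], so at
    most one inverse variable is 0. *)
Lemma invvar_add_neq0 (v : {ffun 'I_(M.*2) -> option 'I_m}) :
  \prod_(i < M.*2) part_weight (nth 0%N lam i) (v i) != 0 ->
  forall i j, i != j -> (invvar \o v) i + (invvar \o v) j != 0.
Proof.
move=> /part_weight_neq0[[u uE] vN].
have vS (i : 'I_(M.*2)) : (i < l)%N -> exists t, v i = Some t.
  by move=> il; exists (u (Ordinal il)); rewrite -uE; congr (v _); apply/val_inj.
have sum_neq0 s t : (x s)^-1 + (x t)^-1 != 0.
  rewrite -[X in X + _]mul1r -[X in _ + X]mul1r addf_div ?x_neq0 // !mul1r.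
  by rewrite mulf_neq0 ?invr_eq0 ?mulf_neq0.
move=> i j ij /=; have [il|il] := ltnP i l; have [jl|jl] := ltnP j l.
- by have [[s ->] [t ->]] := (vS i il, vS j jl); exact: sum_neq0.
- by have [s ->] := vS i il; rewrite vN // addr0 invr_eq0 x_neq0.
- by have [s ->] := vS j jl; rewrite (vN i) // add0r invr_eq0 x_neq0.
case/negP: ij; apply/eqP/val_inj => /=; have iM := ltn_ord i; have jM := ltn_ord j.
by move: l_ge; rewrite -/l; lia.
Qed.

Lemma pfaffian_pair_sum :
  pfaffian (m := M) (\matrix_(i, j) pair_sum (nth 0%N lam i) (nth 0%N lam j)) =
  \sum_v expand_term v.
Proof.
rewrite (@pfaffian_bilinear _ _ M (fun s t => qratio (invvar s) (invvar t))
  (fun i => part_weight (nth 0%N lam i))).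
apply: eq_bigr => v _; rewrite /expand_term.
(* Schur's identity is applied only where the weight is nonzero; elsewhere both terms are 0. *)
have [->|nz] := eqVneq (\prod_(i < M.*2) part_weight (nth 0%N lam i) (v i)) 0.
  by rewrite !mul0r.
by rewrite -(schur_pfaffian (invvar_add_neq0 nz)).
Qed.

Lemma expand_term_neq0 v : expand_term v != 0 ->
  exists u : 'I_l -> 'I_m,
    [/\ injective u, forall i, v (widen_ord l_le i) = Some (u i) &
        forall k : 'I_(M.*2), (l <= k)%N -> v k = None].
Proof.
rewrite /expand_term mulf_eq0 negb_or => /andP[/part_weight_neq0[[u uE] vN] nz].
exists u; split=> // i j uij; apply/eqP; apply: contraNT nz => ij.
apply/eqP/(@qprod_eq0 _ _ _ (widen_ord l_le i) (widen_ord l_le j)).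
  by apply: contra ij => /eqP/(congr1 val)/= ij; apply/eqP/val_inj.
by rewrite /= !uE uij.
Qed.

Section EnoughVariables.
Hypothesis lm : (l <= m)%N.

Definition restrict (w : 'S_m) : {ffun 'I_(M.*2) -> option 'I_m} :=
  [ffun k : 'I_(M.*2) =>
    omap (fun i : 'I_l => w (widen_ord lm i)) (insub (nat_of_ord k))].

Lemma restrict_lt w i : restrict w (widen_ord l_le i) = Some (w (widen_ord lm i)).
Proof. by rewrite ffunE /= valK. Qed.

Lemma restrict_ge w (k : 'I_(M.*2)) : (l <= k)%N -> restrict w k = None.
Proof. by move=> lk; rewrite ffunE insubN // -leqNgt. Qed.

Lemma card_restrict v : expand_term v != 0 ->
  #|[set w | restrict w == v]| = (m - l)`!.
Proof.
case/expand_term_neq0 => u [u_inj uE vN]; rewrite -(card_perm_extend lm u_inj).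
apply: eq_card => w; rewrite !inE; apply/eqP/forallP => [wv i|wu].
  by have := restrict_lt w i; rewrite wv uE => -[->].
apply/ffunP => k; have [kl|lk] := ltnP k l; last by rewrite restrict_ge ?vN.
have -> : k = widen_ord l_le (Ordinal kl) by apply/val_inj.
by rewrite restrict_lt uE (eqP (wu _)).
Qed.

(** Each [v] with a nonzero term is the restriction of (m - l)! permutations; this matches the
    normalising factor of P. *)
Lemma sum_restrict :
  \sum_w expand_term (restrict w) = (m - l)`!%:R * \sum_v expand_term v.
Proof.
rewrite (partition_big restrict predT) //= mulr_sumr; apply: eq_bigr => v _.
have [v0|v0] := eqVneq (expand_term v) 0.
  by rewrite v0 mulr0 big1 // => w /eqP->.
rewrite -(card_restrict v0) mulr_natl -sumr_const.
by apply: eq_big => [w|w /eqP->] //; rewrite inE.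
Qed.

Lemma prod_narrow (F : 'I_(M.*2) -> K) :
  (forall i : 'I_(M.*2), (l <= i)%N -> F i = 1) ->
  \prod_i F i = \prod_(i < l) F (widen_ord l_le i).
Proof.
move=> F1; rewrite (bigID (fun i : 'I_(M.*2) => (i < l)%N)) /=.
rewrite [X in _ * X]big1 ?mulr1 => [|i]; last by rewrite -leqNgt => /F1.
exact: big_ord_narrow.
Qed.

(** In the weight of [y i], the variables placed after position i give the product in [symm_sum];
    those placed before it cancel against [qprod]. *)
Lemma symm_sumE w : 2%:R ^+ l * symm_sum lam w = expand_term (restrict w).
Proof.
pose y (i : 'I_l) := w (widen_ord lm i).
pose r i j := (x i + x j) / (x i - x j).
have wE : \prod_(i < M.*2) part_weight (nth 0%N lam i) (restrict w i) =
    \prod_(i < l) (2%:R * f (nth 0%N lam i) (y i) * \prod_(j | j != y i) r (y i) j).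
  rewrite prod_narrow => [|i li]; last by rewrite restrict_ge // nth_default.
  by apply: eq_bigr => i _; rewrite restrict_lt /= lam_gt0.
have qE : qprod (invvar \o restrict w) =
    \prod_(i < l) \prod_(j < l | (j < i)%N) (r (y i) (y j))^-1.
  rewrite /qprod prod_narrow => [|i li].
    apply: eq_bigr => i _; rewrite big_mkcond prod_narrow /= => [|j lj].
      rewrite -big_mkcond; apply: eq_bigr => j _; rewrite !restrict_lt /=.
      by rewrite qratio_inv ?x_neq0 ?x_add // /r invf_div.
    by rewrite ltnNge ltnW // (leq_trans _ lj).
  (* The extra index has inverse variable 0, so its factors are (z - 0) / (z + 0) = 1. *)
  apply: big1 => j ji; rewrite /= (restrict_ge w li) /= /qratio subr0 addr0.
  have jl : (j < l)%N by have iM := ltn_ord i; move: l_ge; rewrite -/l; lia.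
  have -> : j = widen_ord l_le (Ordinal jl) by apply/val_inj.
  by rewrite restrict_lt /= divff // invr_eq0.
rewrite /expand_term wE qE /symm_sum -/l.
rewrite big_ord_narrow [X in _ * (_ * X)]big_ord_narrow.
have -> : 2%:R ^+ l = \prod_(i < l) 2%:R :> K by rewrite prodr_const card_ord.
rewrite -!big_split /=.
apply: eq_bigr => i _; rewrite -/(y i) -!mulrA; congr (_ * (_ * _)).
have -> : \prod_(j | j != y i) r (y i) j =
    \prod_(j | (w j != y i) && (i < j)%N) r (y i) (w j) *
    \prod_(j | (w j != y i) && ~~ (i < j)%N) r (y i) (w j).
  by rewrite (reindex_perm w) /= (bigID (fun j : 'I_m => (i < j)%N)).
rewrite -mulrA.
have neE j : (w j != y i) = (j != i :> nat) by rewrite (inj_eq perm_inj) -val_eqE.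
rewrite [X in _ = _ * X](_ : _ = 1) ?mulr1.
  by apply: eq_bigl => j; rewrite neE; lia.
have -> : \prod_(j | (w j != y i) && ~~ (i < j)%N) r (y i) (w j) =
    \prod_(j < l | (j < i)%N) r (y i) (y j).
  transitivity (\prod_(j < m | (j < i)%N && (j < l)%N) r (y i) (w j)); last first.
    exact: big_ord_narrow_cond.
  apply: eq_bigl => j.
  by rewrite neE; have := ltn_ord i; lia.
rewrite prodfV divff //; apply/prodf_neq0 => j ji.
rewrite mulf_neq0 ?x_add // invr_eq0 subr_eq0 (inj_eq x_inj) (inj_eq perm_inj).
by rewrite -val_eqE /= gtn_eqF.
Qed.

End EnoughVariables.

Lemma schur_sum_pfaffian :
  (if (l <= m)%N then
     2%:R ^+ l * (((m - l)`!%:R)^-1 * \sum_w symm_sum lam w)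
   else 0) =
  pfaffian (m := M) (\matrix_(i, j) pair_sum (nth 0%N lam i) (nth 0%N lam j)).
Proof.
rewrite pfaffian_pair_sum; case: ifPn => [lm|ml]; last first.
  (* With fewer variables than parts there is no injection, hence no nonzero term. *)
  rewrite big1 // => v _; apply: contraNeq ml => /expand_term_neq0[u [u_inj _ _]].
  by have := leq_card u u_inj; rewrite !card_ord.
rewrite mulrCA mulr_sumr (eq_bigr _ (fun w _ => symm_sumE lm w)) (sum_restrict lm).
by rewrite mulKf // -(prednK (fact_gt0 (m - l))).
Qed.

End Parts.
End SchurQFormula.

(** * Passage to the field of rational functions *)

Lemma mpolyX_add_neq0 (F : fieldType) (m : nat) (i j : 'I_m) :
  2%:R != 0 :> F -> 'X_i + 'X_j != 0 :> {mpoly F[m]}.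
Proof.
move=> two; apply/eqP => /(congr1 (mcoeff U_(i))).
rewrite mcoeffD !mcoeffX mcoeff0 eqxx.
have [_|_] := eqVneq U_(j)%MM U_(i)%MM; last by move/eqP; rewrite addr0 oner_eq0.
by move/eqP; rewrite -[_ + _]/(2%:R) (negPf two).
Qed.

Section SchurQ2.
Variables (F : fieldType) (a : nat -> F) (m : nat).
Hypothesis natF : forall n, n.+1%:R != 0 :> F.

Let x := @ratvar F m.
Let f p u := gen_power (ratparam a m) (x u) p.

Lemma ratvar_inj : injective x.
Proof.
move=> i j /eqP; rewrite tofrac_eq => /eqP/(congr1 (mcoeff U_(i))).
rewrite !mcoeffX !eq_mnm1 eqxx; case: eqVneq => // _ /eqP.
by rewrite oner_eq0.
Qed.

Lemma ratvar_add_neq0 i j : x i + x j != 0.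
Proof. by rewrite -tofracD tofrac_eq0 mpolyX_add_neq0. Qed.

Lemma ratfun_natr n : n.+1%:R != 0 :> ratfun F m.
Proof.
rewrite -(rmorph_nat (@tofrac _)) tofrac_eq0 -(rmorph_nat (@mpolyC m F)).
by rewrite mpolyC_eq0.
Qed.

Lemma schurQ_pfaffian (lam : seq nat) M :
  (forall i, (i < size lam)%N -> (0 < nth 0%N lam i)%N) ->
  (size lam <= M.*2)%N -> (M.*2 <= (size lam).+1)%N ->
  schurQ a lam m =
  pfaffian (m := M) (\matrix_(i, j) pair_sum x f (nth 0%N lam i) (nth 0%N lam j)).
Proof.
move=> lam_gt0 l_le l_ge.
rewrite -(schur_sum_pfaffian f ratfun_natr ratvar_add_neq0 ratvar_inj) //.
by rewrite /schurQ /schurP; case: ifP => _; rewrite ?mulr0.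
Qed.

(** This is the case M = 1, where the Pfaffian is a single entry; for q = 0 the second part is the
    padding zero. *)
Lemma schurQ2E p q : (q < p)%N -> schurQ2 a p q m = pair_sum x f p q.
Proof.
move=> qp; rewrite /schurQ2 qp /= (leq_ltn_trans _ qp) //.
case: posnP => [->|q0] /=; rewrite (@schurQ_pfaffian _ 1) ?pfaffian2 ?mxE //.
  by case=> // _; apply: leq_ltn_trans qp.
by case=> [|[|]] //= _; apply: leq_ltn_trans qp.
Qed.

End SchurQ2.

Theorem theorem9p1 (R : realType) (a : nat -> R[i]) (ha : a 1%N = 0)
    (lam : seq nat) (hlam : strict_partition lam) (m : nat) :
  schurQ a lam m =
  pfaffian (m := ((size lam).+1 %/ 2)%N)
    (\matrix_(i, j) schurQ2 a (nth 0%N lam i) (nth 0%N lam j) m).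
Proof.
have natC n : n.+1%:R != 0 :> R[i] by rewrite pnatr_eq0.
case/andP: hlam => lam_sorted lam0.
have lam_gt0 i : (i < size lam)%N -> (0 < nth 0%N lam i)%N.
  by move=> il; rewrite lt0n; apply: contra lam0 => /eqP <-; apply: mem_nth.
rewrite (schurQ_pfaffian a m natC lam_gt0 (M := ((size lam).+1 %/ 2)%N)); try lia.
apply: eq_pfaffian => i j ij; rewrite !mxE schurQ2E //.
(* Above the diagonal i < j <= l, so entry i of [lam] is a genuine part, while entry j is the
   padding zero when j = l. *)
have il : (i < size lam)%N by have := ltn_ord j; move: ij; lia.
have [jl|lj] := ltnP j (size lam); last by rewrite (nth_default _ lj) lam_gt0.
have gtn_trans : transitive gtn by move=> u v w vu uw; apply: ltn_trans uw vu.
exact: (sorted_ltn_nth gtn_trans).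
Qed.
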